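(* Let $P\in\mathcal{B}(\mathcal{H})$ be an idempotent. Then the following statements are equivalent: (i) There exists a symmetry $J\in\mathcal{B}(\mathcal{H})$ such that $JPJ=I-P^{*}$. (ii) $\dim N(P+P^{*})=\dim N(2I-P-P^{*})$. (iii) There exists a unitary operator $U\in\mathcal{B}(\mathcal{H})$ such that $UPU^{*}=I-P^{*}$.
   Context: $\mathcal{H}$ is a separable complex Hilbert space and $\mathcal{B}(\mathcal{H})$ is the set of bounded linear operators on $\mathcal{H}$. An idempotent is $P\in\mathcal{B}(\mathcal{H})$ with $P^2=P$ (not necessarily self-adjoint). A symmetry is an operator $J$ with $J=J^*=J^{-1}$. $N(T)$ denotes the null space of $T$; $\dim$ is the Hilbert space dimension. *)

(* Defs.v *)
From mathcomp Require Import all_boot all_order all_algebra.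
From mathcomp Require Import complex.
From mathcomp Require Import all_classical reals topology normedtype.

Set Implicit Arguments.
Unset Strict Implicit.
Unset Printing Implicit Defensive.

Import Order.TTheory GRing.Theory Num.Theory.

Local Open Scope classical_set_scope.
Local Open Scope complex_scope.
Local Open Scope ring_scope.

Definition separable (T : topologicalType) : Prop :=
  exists2 D : set T, countable D & dense D.

Section HilbertSpace.
Context {R : realType} {H : completeNormedModType R[i]}.
Variable dot : {dot H for Num.conj}.

(* [dot] is the inner product of the Hilbert space [H], linear in its first
   argument and conjugate-linear in the second. *)
Definition induces_norm : Prop := forall x : H, `|x| ^+ 2 = dot x x.

Definition bounded_operator (T : H -> H) : Prop :=
  linear T /\ exists M : R, forall x : H, `|T x| <= M%:C * `|x|.

(* For a bounded operator [T], the Riesz representation theorem provides the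
   unique [z] such that <T x, y> = <x, z> for all [x]; [get] selects it. *)
Definition adjoint (T : H -> H) (y : H) : H :=
  get [set z : H | forall x : H, dot (T x) y = dot x z].

Definition idempotent_operator (P : H -> H) : Prop :=
  bounded_operator P /\ P \o P = P.

Definition symmetry (J : H -> H) : Prop :=
  [/\ bounded_operator J, adjoint J = J & J \o J = idfun].

Definition unitary (U : H -> H) : Prop :=
  [/\ bounded_operator U, adjoint U \o U = idfun & U \o adjoint U = idfun].

Definition null_space (T : H -> H) : set H := [set x | T x = 0].

Definition orthonormal_set (B : set H) : Prop :=
  (forall b, B b -> dot b b = 1) /\
  (forall b c, B b -> B c -> b != c -> dot b c = 0).

(* A Hilbert basis of a closed subspace [M] is a maximal orthonormal subset of
   [M]. *)
Definition hilbert_basis (M B : set H) : Prop :=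
  [/\ B `<=` M, orthonormal_set B &
      forall B' : set H, B' `<=` M -> orthonormal_set B' -> B `<=` B' -> B' = B].

(* The Hilbert dimension of a closed subspace is the cardinality of its Hilbert
   bases.  Every closed subspace has one, and all of them have the same
   cardinality, so equality of dimensions does not depend on the choice of the
   two bases. *)
Definition eq_hilbert_dim (M N : set H) : Prop :=
  exists A B : set H, [/\ hilbert_basis M A, hilbert_basis N B & (A #= B)%card].

End HilbertSpace.

(* Main.v *)
Require Import Defs.
From mathcomp Require Import all_boot all_order all_algebra.
From mathcomp Require Import complex ring lra.
From mathcomp Require Import all_classical reals interval_inference.
From mathcomp Require Import topology normedtype sequences.

(** Write Q for the adjoint of the idempotent P.

    If U is unitary and U P U^* = I - Q, taking adjoints gives
    U Q U^* = I - P, so U carries P + Q to 2I - P - Q and hence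
    N(P + Q) isometrically onto N(2I - P - Q); a symmetry is a particular
    unitary.  This proves that (i) implies (iii) and that (iii) implies (ii)
    ([eq_hilbert_dim_conj]); Hilbert bases exist by Zorn's lemma.

    For (ii) => (i), consider the self-adjoint operator T = ic(P - Q), with
    c > 0 so small that T is a contraction ([skew_part]).  Since P and Q are
    idempotent, P T = T (I - Q) and Q T = T (I - P).  The sign J0 of T, that is
    the partial isometry of the polar decomposition T = J0 |T|, inherits these
    relations: it is self-adjoint, satisfies J0^3 = J0, has the kernel of T, and
    P J0 = J0 (I - Q).  So J0 has the required properties on the orthogonal
    complement of N(T).  On N(T) = {x | P x = Q x} the operators P and Q
    coincide with an orthogonal projection, whose kernel and range in N(T) are
    N(P + Q) and N(2I - P - Q).  When these have the same dimension there is an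
    isometry W of one onto the other ([null_spaces_isometric]), and the operator
    J1 that exchanges them through W and its inverse satisfies
    P J1 = J1 (I - P) ([kernel_swap]).  With E = I - J0^2 the projection on N(T),
    J = J0 + J1 E is the symmetry looked for ([idempotent_symmetry]).

    The sign is obtained without spectral theory ([sign_operator]), as the
    strong limit of the polynomials of the Newton-Schulz iteration
    x |-> x (3 - x^2) / 2, started at T.  All the operator inequalities that
    this needs say that p(T) is positive for some polynomial p that is
    nonnegative on [-1, 1]; they follow from the fact that each such p belongs
    to the cone generated by the q^2 and the q^2 (1 - X^2), which is
    stable under products.  These inequalities make the iterates Cauchy at every
    vector, because the square of a difference of iterates is bounded by the
    difference of their squares.  The same convergence criterion
    ([monotone_tends]) gives the series W x = sum <x, a_n> b_n that
    carries a countable orthonormal basis a to b. *)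

Set Implicit Arguments.
Unset Strict Implicit.
Unset Printing Implicit Defensive.

Import Order.TTheory GRing.Theory Num.Theory.
Import numFieldNormedType.Exports.

Local Open Scope classical_set_scope.
Local Open Scope complex_scope.
Local Open Scope ring_scope.

(** * Linear maps and inner products *)

Section LinearMaps.
Context {K : pzRingType} {U V : lmodType K} {A : U -> V}.
Hypothesis lA : linear A.

Lemma linD x y : A (x + y) = A x + A y.
Proof. by rewrite -{1}[x]scale1r lA scale1r. Qed.

Lemma lin0 : A 0 = 0.
Proof. by apply: (addrI (A 0)); rewrite -linD !addr0. Qed.

Lemma linZ a x : A (a *: x) = a *: A x.
Proof. by rewrite -[a *: x]addr0 lA lin0 addr0. Qed.

Lemma linN x : A (- x) = - A x.
Proof. by rewrite -scaleN1r linZ scaleN1r. Qed.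

Lemma linB x y : A (x - y) = A x - A y.
Proof. by rewrite -scaleN1r addrC lA scaleN1r addrC. Qed.

End LinearMaps.

Section InnerProduct.
Context {R : realType} {H : completeNormedModType R[i]}.
Variable dot : {dot H for Num.conj}.
Hypothesis dot_norm : induces_norm dot.
Local Notation "''[' u , v ]" := (dot u%R v%R) : ring_scope.

Lemma dotC u v : '[u, v] = Num.conj '[v, u].
Proof. by rewrite hermC /= expr0 mul1r. Qed.

Lemma dotZl a u v : '[a *: u, v] = a * '[u, v].
Proof. by rewrite linearZl_LR. Qed.

Lemma dotZr a u v : '[u, a *: v] = Num.conj a * '[u, v].
Proof. by rewrite linearZr_LR. Qed.

Lemma dotDl u v w : '[u + v, w] = '[u, w] + '[v, w]. Proof. exact: linearDl. Qed.
Lemma dotDr u v w : '[w, u + v] = '[w, u] + '[w, v]. Proof. exact: linearDr. Qed.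
Lemma dotBl u v w : '[u - v, w] = '[u, w] - '[v, w]. Proof. exact: linearBl. Qed.
Lemma dotBr u v w : '[w, u - v] = '[w, u] - '[w, v]. Proof. exact: linearBr. Qed.
Lemma dot0l w : '[0, w] = 0. Proof. exact: linear0l. Qed.
Lemma dot0r w : '[w, 0] = 0. Proof. exact: linear0r. Qed.
Lemma dotNl u w : '[- u, w] = - '[u, w]. Proof. exact: linearNl. Qed.
Lemma dotNr u w : '[w, - u] = - '[w, u]. Proof. exact: linearNr. Qed.

(** The rules for differences come first: tried after them, those for sums would
    split off an opposite. *)
Definition dotE :=
  (dotBl, dotBr, dotDl, dotDr, dotNl, dotNr, dotZl, dotZr, dot0l, dot0r).

Lemma dot_ext u v : (forall w, '[u, w] = '[v, w]) -> u = v.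
Proof.
move=> uv; apply/eqP; rewrite -subr_eq0 -normr_eq0 -sqrf_eq0 dot_norm.
by rewrite dotBl uv subrr.
Qed.

(** The squared norm as an element of [R], where the order is total and limits
    can be compared. *)
Definition nsq (u : H) : R := complex.Re '[u, u].

Lemma nsqE u : '[u, u] = (nsq u)%:C.
Proof.
rewrite /nsq -dot_norm.
have : `|u| ^+ 2 \is Num.real by rewrite realX // normr_real.
by move=> /complex_realP[r ->].
Qed.

Lemma nsq_ge0 u : 0 <= nsq u.
Proof. by rewrite -ler0c -nsqE -dot_norm exprn_ge0. Qed.

Lemma nsq_eq0 u : nsq u = 0 -> u = 0.
Proof.
move=> u0; apply/eqP; rewrite -normr_eq0 -sqrf_eq0 dot_norm nsqE u0.
by rewrite eqxx.
Qed.

Lemma nsqB u v : nsq (u - v) = nsq u + nsq v - 2 * complex.Re '[u, v].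
Proof.
rewrite /nsq !dotE (dotC v u).
by case: '[u, v] => a b; case: '[u, u] => c d; case: '[v, v] => e f /=; ring.
Qed.

Lemma cauchy_schwarz u v : `|'[u, v]| <= `|u| * `|v|.
Proof.
rewrite -ler_sqr ?nnegrE ?mulr_ge0// exprMn !dot_norm normCK -dotC.
have [->|v0] := eqVneq v 0; first by rewrite !dot0r !mulr0 mul0r.
have vp : 0 < '[v, v] by rewrite -dot_norm exprn_gt0 // normr_gt0.
rewrite -subr_ge0 -(pmulr_rge0 _ vp).
(* a multiple of the component of u orthogonal to v *)
have : 0 <= '[ '[v, v] *: u - '[u, v] *: v, '[v, v] *: u - '[u, v] *: v].
  by rewrite -dot_norm exprn_ge0.
by rewrite !dotE -!dotC; congr (_ <= _); ring.
Qed.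

Lemma nsq0 : nsq 0 = 0. Proof. by rewrite /nsq dot0l. Qed.

Lemma nsqN u : nsq (- u) = nsq u.
Proof. by rewrite /nsq dotNl dotNr opprK. Qed.

Lemma nsqD u v : nsq (u + v) = nsq u + nsq v + 2 * complex.Re '[u, v].
Proof. by rewrite -{1}[v]opprK nsqB nsqN dotNr raddfN /= mulrN opprK. Qed.

Lemma conj_real (a : R) : Num.conj (a%:C : R[i]) = a%:C.
Proof. exact: conjc_real. Qed.

Lemma nsqZ (a : R) u : nsq (a%:C *: u) = a ^+ 2 * nsq u.
Proof.
rewrite /nsq !dotE conj_real; case: '[u, u] => x y /=.
by rewrite !mul0r !subr0 mulrA.
Qed.

Lemma nsqD_le u v : nsq (u + v) <= 2 * nsq u + 2 * nsq v.
Proof. by have := nsq_ge0 (u - v); rewrite nsqB nsqD; lra. Qed.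

Lemma cauchy_schwarz_Re u v : complex.Re '[u, v] ^+ 2 <= nsq u * nsq v.
Proof.
have /(le_trans (normc_ge_Re _)) := cauchy_schwarz u v.
rewrite -ler_sqr ?nnegrE ?mulr_ge0 ?ler0c// exprMn !dot_norm !nsqE.
by rewrite -rmorphXn -rmorphM lecR real_normK// num_real.
Qed.

(** * Convergence of sequences of vectors *)

Definition tends (u : nat -> H) (l : H) := nsq (u n - l) @[n --> \oo] --> 0.

Lemma le_null_seq (c : R) (r : nat -> R) :
  r n @[n --> \oo] --> 0 -> (forall n, c <= r n) -> c <= 0.
Proof. by move=> r0 cr; apply: (cvgr_to_ge r0); apply: nearW. Qed.

Lemma dot_lim_Re u v l k x y : tends u l -> tends v k ->
  (forall n, complex.Re '[u n, x] = complex.Re '[y, v n]) ->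
  complex.Re '[l, x] = complex.Re '[y, k].
Proof.
move=> ul vk uv; apply/eqP; rewrite -subr_eq0 -sqrf_eq0 eq_le sqr_ge0 andbT.
pose r n := nsq (u n - l) * (2 * nsq x) + nsq (v n - k) * (2 * nsq y).
apply: (@le_null_seq _ r) => [|n].
  rewrite -[X in _ --> X](_ : 0 * (2 * nsq x) + 0 * (2 * nsq y) = 0);
    last by ring.
  by apply: cvgD; apply: cvgM => //; exact: cvg_cst.
have := cauchy_schwarz_Re (u n - l) x; have := cauchy_schwarz_Re y (v n - k).
rewrite /r !dotE !raddfB /= uv.
move: (complex.Re '[y, v n]) (complex.Re '[y, k]) (complex.Re '[l, x]) => a b c.
have : 0 <= ((a - b) + (a - c)) ^+ 2 by exact: sqr_ge0.
move: (nsq _) (nsq _) (nsq _) (nsq _) => p q s t; nra.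
Qed.

(** The form in which adjunction identities are passed to strong limits. *)
Lemma dot_lim u v l k x y : tends u l -> tends v k ->
  (forall n, '[u n, x] = '[y, v n]) -> '[l, x] = '[y, k].
Proof.
move=> ul vk uv; have re := dot_lim_Re ul vk.
(* imaginary parts are the real parts for the vectors multiplied by i and -i *)
have {re}reJ z w := re ((0 +i* 1)%C *: z) ((0 -i* 1)%C *: w).
have := dot_lim_Re ul vk (fun n => congr1 (@complex.Re R) (uv n)).
have := reJ x y _.
rewrite !dotE; case: '[l, x] => a b; case: '[y, k] => c d /=.
rewrite !mul0r !sub0r !mulN1r !opprK => bd ->; congr (_ +i* _).
by apply: bd => n; rewrite !dotE uv.
Qed.

Lemma tends_unique u l k : tends u l -> tends u k -> l = k.
Proof.
move=> ul uk; apply/eqP; rewrite -subr_eq0; apply/eqP/nsq_eq0/eqP.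
rewrite eq_le nsq_ge0 andbT.
pose r n := 2 * nsq (u n - l) + 2 * nsq (u n - k).
apply: (@le_null_seq _ r) => [|n].
  rewrite -[X in _ --> X](_ : 2 * 0 + 2 * 0 = 0); last by rewrite mulr0 addr0.
  by apply: cvgD; apply: cvgM => //; exact: cvg_cst.
have -> : l - k = - (u n - l) + (u n - k).
  by rewrite opprB addrA subrK.
by rewrite (le_trans (nsqD_le _ _))// nsqN.
Qed.

Lemma cauchy_tends u :
  (forall e : R, 0 < e -> exists N, forall m n, (N <= m)%N -> (N <= n)%N ->
     nsq (u m - u n) <= e) ->
  exists l, tends u l.
Proof.
move=> cu.
have /cvg_ex[/= l ul] : cvg (u @ \oo).
  apply: cauchy_cvg; apply: cauchy_exP => e e0.
  have /complex_realP[d ed] : e \is Num.real by exact: gtr0_real.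
  have d0 : 0 < d by rewrite -ltcR -ed.
  have [|N NP] := cu (d ^+ 2 / 2); first by rewrite divr_gt0// exprn_gt0.
  exists (u N), N => // n /= Nn; rewrite -ball_normE /ball_ /=.
  rewrite -ltr_sqr ?nnegrE ?(ltW e0)// dot_norm nsqE ed -rmorphXn ltcR.
  apply: le_lt_trans (NP N n (leqnn _) Nn) _.
  by rewrite ltr_pdivrMr// ltr_pMr ?exprn_gt0// ltr1n.
exists l; apply/cvgr0Pnorm_le => e e0.
have s0 : 0 < (Num.sqrt e)%:C :> R[i] by rewrite ltcR sqrtr_gt0.
move/cvgrPdist_le/(_ _ s0): ul; apply: filterS => n.
move=> /(lerXn2r 2%N); rewrite !nnegrE normr_ge0 (ltW s0) => /(_ isT isT).
rewrite dot_norm nsqE -rmorphXn lecR.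
by rewrite ger0_norm ?nsq_ge0// sqr_sqrtr ?(ltW e0)// -nsqN opprB.
Qed.

(** The increments of [u] are controlled by those of [b], which is then
    nondecreasing and bounded, hence Cauchy. *)
Lemma monotone_tends u (b : nat -> R) (B : R) :
  (forall m n, (n <= m)%N -> nsq (u m - u n) <= b m - b n) ->
  (forall n, b n <= B) -> exists l, tends u l.
Proof.
move=> ub bB; apply: cauchy_tends => e e0.
have bsup : has_sup (range b).
  by split; [exists (b 0%N), 0%N | exists B => _ [n _ <-]].
have [_ [N _ <-] bN] := sup_adherent e0 bsup.
have le_sup n : b n <= sup (range b) by apply: sup_upper_bound => //; exists n.
have mono m n : (n <= m)%N -> b n <= b m.
  by move=> /ub /(le_trans (nsq_ge0 _)); rewrite subr_ge0.
exists N => m n Nm Nn; wlog nm : m n Nm Nn / (n <= m)%N.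
  move=> W; have /orP[/W|/W] := leq_total n m; first exact.
  by rewrite -nsqN opprB; exact.
apply: le_trans (ub _ _ nm) _; have := mono _ _ Nn; have := le_sup m; lra.
Qed.

Lemma tendsD u v l k : tends u l -> tends v k -> tends (fun n => u n + v n) (l + k).
Proof.
move=> ul vk; pose r n := 2 * nsq (u n - l) + 2 * nsq (v n - k).
apply: (@squeeze_cvgr _ \oo _ R (fun=> 0) r).
- by apply: nearW => n; rewrite nsq_ge0 opprD addrACA nsqD_le.
- exact: cvg_cst.
- rewrite -[X in _ --> X](_ : 2 * 0 + 2 * 0 = 0); last by rewrite mulr0 addr0.
  by apply: cvgD; apply: cvgM => //; exact: cvg_cst.
Qed.

Lemma tendsZ (a : R) u l : tends u l -> tends (fun n => a%:C *: u n) (a%:C *: l).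
Proof.
move=> ul; rewrite /tends (_ : (fun n => _) = (fun n => a ^+ 2 * nsq (u n - l))).
  rewrite -[X in _ --> X](mulr0 (a ^+ 2)); apply: cvgM => //; exact: cvg_cst.
by apply/funext => n; rewrite -scalerBr nsqZ.
Qed.

Lemma tends_shift u l : tends u l -> tends (fun n => u n.+1) l.
Proof. by move=> ul; rewrite /tends (cvg_shiftS (fun n => nsq (u n - l))). Qed.

(** * Riesz representation and adjoints *)

Lemma real_scalar_linear (f : H -> R[i]) (flin : linear_for *%R f) (t : R) x y :
  complex.Re (f (t%:C *: x + y)) = t * complex.Re (f x) + complex.Re (f y).
Proof.
by rewrite flin; case: (f x) (f y) => a b [c d] /=; rewrite mul0r subr0.
Qed.

(** The representing vector minimizes |z|^2 - 2 Re (f z): by the parallelogram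
    identity minimizing sequences are Cauchy, and the first variation at the
    minimum in the direction x is the difference of the real parts of <x, z>
    and f x. *)
Lemma riesz (f : H -> R[i]) : linear_for *%R f ->
  (exists M : R, forall x, `|f x| <= M%:C * `|x|) ->
  exists z, forall x, f x = '[x, z].
Proof.
move=> flin [M fM]; have fE := real_scalar_linear flin.
have f0 : f 0 = 0.
  by rewrite -[X in f X](subrr 0) -scaleN1r addrC flin mulN1r addNr.
pose phi z := nsq z - 2 * complex.Re (f z).
have fM2 z : complex.Re (f z) ^+ 2 <= M ^+ 2 * nsq z.
  have /(lerXn2r 2%N) := le_trans (normc_ge_Re _) (fM z).
  rewrite !nnegrE ler0c normr_ge0 (le_trans _ (fM z))// => /(_ isT isT).
  by rewrite exprMn dot_norm nsqE -!rmorphXn -rmorphM lecR real_normK// num_real.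
have phi_lb z : - M ^+ 2 <= phi z.
  rewrite /phi; have := fM2 z; have := nsq_ge0 z; have := sqr_ge0 M.
  move: (complex.Re _) (nsq z) (M ^+ 2) => r s K K0 s0 rK.
  suff : 2 * r <= s + K by lra.
  apply: le_trans (ler_norm _) _; rewrite -ler_sqr ?nnegrE ?addr_ge0//.
  rewrite real_normK ?num_real//; have := sqr_ge0 (s - K); nra.
have phi_inf : has_inf (range phi).
  by split; [exists (phi 0), 0 | exists (- M ^+ 2) => _ [z _ <-]].
pose d := inf (range phi).
have d_le z : d <= phi z by apply: ge_inf; [case: phi_inf | exists z].
have /choice[z zP] : forall n : nat, exists z, phi z < d + n.+1%:R^-1.
  move=> n; have n0 : 0 < n.+1%:R^-1 :> R by rewrite invr_gt0 ltr0n.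
  by have [_ [z _ <-] zn] := inf_adherent n0 phi_inf; exists z.
have [|l zl] := @cauchy_tends z.
  move=> e e0; have e40 : 0 < e / 4 by rewrite divr_gt0.
  have [N _ NP] := near_infty_natSinv_lt (PosNum e40).
  exists N => m n /NP/= me /NP/= ne.
  (* compare with the value at the midpoint *)
  have := d_le (2^-1%:C *: (z m + z n) + 0); rewrite /phi fE addr0 nsqZ f0 /=.
  have -> : complex.Re (f (z m + z n)) =
      complex.Re (f (z m)) + complex.Re (f (z n)).
    by rewrite -[z m]scale1r flin mul1r scale1r raddfD.
  have := zP m; have := zP n; move: me ne; rewrite /phi nsqD nsqB expr2 /=.
  move: (m.+1%:R^-1) (n.+1%:R^-1) => p q; lra.
have Ref x : complex.Re '[x, l] = complex.Re (f x).
  apply/eqP; rewrite -subr_eq0 -sqrf_eq0 eq_le sqr_ge0 andbT.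
  pose q n := (2 * (nsq x + 1)) * n.+1%:R^-1 + nsq (z n - l) * (2 * nsq x).
  apply: (@le_null_seq _ q) => [|n].
    rewrite -[X in _ --> X](_ : 2 * (nsq x + 1) * 0 + 0 * (2 * nsq x) = 0);
      last by ring.
    by apply: cvgD; apply: cvgM => //; (exact: cvg_cst || exact: cvg_harmonic).
  have := cauchy_schwarz_Re x (z n - l); rewrite /q dotBr raddfB /=.
  set c := complex.Re '[x, z n] - complex.Re (f x).
  (* moving z n by - s c x, with this s, would decrease phi by at least s c^2 *)
  pose s := (nsq x + 1)^-1.
  have nx1 : 0 < nsq x + 1 by rewrite ltr_wpDl ?nsq_ge0.
  have s0 : 0 < s by rewrite invr_gt0.
  have ss : s * nsq x = 1 - s.
    have <- : s * (nsq x + 1) = 1 by rewrite mulVf ?gt_eqF.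
    by rewrite mulrDr mulr1 addrK.
  have sc : s * c ^+ 2 <= n.+1%:R^-1.
    have := d_le ((- (s * c))%:C *: x + z n); have := zP n.
    rewrite /phi fE nsqD nsqZ dotZl.
    have -> : complex.Re ((- (s * c))%:C * '[x, z n]) =
        - (s * c) * (c + complex.Re (f x)).
      by rewrite /c subrK; case: '[x, z n] => a b /=; rewrite mul0r subr0.
    have -> : (- (s * c)) ^+ 2 * nsq x = s * c ^+ 2 * (1 - s).
      by rewrite -ss; ring.
    have : 0 <= s * s * c ^+ 2.
      by rewrite mulr_ge0 ?sqr_ge0// mulr_ge0 ?(ltW s0).
    by move: (n.+1%:R^-1) => N; clearbody c s; clear; lra.
  have {}sc : c ^+ 2 <= (nsq x + 1) * n.+1%:R^-1.
    by rewrite -(ler_pdivrMl _ _ nx1).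
  have := sqr_ge0 (c + (complex.Re '[x, z n] - complex.Re '[x, l])).
  rewrite /c in sc *.
  move: (complex.Re _) (complex.Re _) (complex.Re _) sc => a b t.
  move: (nsq _) (nsq _) => p q'.
  by move: (n.+1%:R^-1) => N; nra.
(* apply it to ix as well, to get the imaginary part *)
exists l => x; have := Ref ((0 +i* 1)%C *: x); have := Ref x.
have -> : f ((0 +i* 1)%C *: x) = (0 +i* 1)%C * f x.
  by rewrite -[_ *: x]addr0 flin f0 addr0.
rewrite !dotE; case: '[x, l] (f x) => a b [c d'] /= ->.
by rewrite !mul0r !mul1r !sub0r => /oppr_inj ->.
Qed.

Definition adjoint_pair (A A' : H -> H) := forall x y, '[A x, y] = '[x, A' y].

Lemma adjoint_pairC A A' : adjoint_pair A A' -> adjoint_pair A' A.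
Proof. by move=> AA' x y; rewrite dotC -AA' -dotC. Qed.

(** A map with an everywhere defined adjoint is linear, so that linearity never
    has to be checked for the operators built below as limits. *)
Lemma adjoint_pair_linear A A' : adjoint_pair A A' -> linear A.
Proof. by move=> AA' a x y; apply: dot_ext => w; rewrite AA' !dotE !AA'. Qed.

Lemma adjoint_pair_inj A A' A'' :
  adjoint_pair A A' -> adjoint_pair A A'' -> A' = A''.
Proof.
move=> a1 a2; apply/funext => y; apply: dot_ext => w.
by rewrite -[LHS]conjCK -dotC -a1 a2 dotC conjCK.
Qed.

Lemma bounded_nsq (T : H -> H) : bounded_operator T ->
  exists2 K : R, 0 < K & forall x, nsq (T x) <= K * nsq x.
Proof.
move=> [_ [M TM]]; exists (M ^+ 2 + 1) => [|x]; first by rewrite ltr_wpDl ?sqr_ge0.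
have /(lerXn2r 2%N) := TM x; rewrite !nnegrE normr_ge0 (le_trans _ (TM x))//.
move=> /(_ isT isT); rewrite exprMn !dot_norm !nsqE -rmorphXn -rmorphM lecR.
by have := nsq_ge0 x; lra.
Qed.

Lemma nsq_bounded (T : H -> H) (K : R) : linear T ->
  (forall x, nsq (T x) <= K ^+ 2 * nsq x) -> bounded_operator T.
Proof.
move=> lT TK; split=> //; exists `|K| => x.
rewrite -ler_sqr ?nnegrE ?mulr_ge0 ?ler0c// exprMn !dot_norm !nsqE.
by rewrite -rmorphXn -rmorphM lecR real_normK// num_real.
Qed.

Lemma adjointP (T : H -> H) : bounded_operator T -> adjoint_pair T (adjoint dot T).
Proof.
move=> bT x y; have [lT [M TM]] := bT.
have [||z Tz] := @riesz (fun x => '[T x, y]).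
- by move=> a u v; rewrite lT !dotE.
- exists (M * complex.Re `|y|) => u; apply: le_trans (cauchy_schwarz _ _) _.
  have -> : (M * complex.Re `|y|)%:C = M%:C * `|y|.
    have /complex_realP[r ->] : `|y| \is Num.real by rewrite normr_real.
    by rewrite rmorphM.
  by rewrite mulrAC ler_wpM2r.
have : [set z | forall x, '[T x, y] = '[x, z]] (adjoint dot T y).
  by apply: getPex; exists z.
exact.
Qed.

(** * The sign of a self-adjoint contraction *)

Section SignOperator.
Variable T : H -> H.
Hypothesis symT : adjoint_pair T T.
Hypothesis contrT : forall x, nsq (T x) <= nsq x.
Implicit Types p q : {poly R}.

Let lT := adjoint_pair_linear symT.

Definition ev p x := \sum_(i < size p) (p`_i)%:C *: iter i T x.

Lemma ev_widen n p x : (size p <= n)%N ->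
  ev p x = \sum_(i < n) (p`_i)%:C *: iter i T x.
Proof.
move=> pn; rewrite /ev (big_ord_widen n (fun i => (p`_i)%:C *: iter i T x) pn).
rewrite big_mkcond; apply: eq_bigr => i _; case: ifP => // /negbT.
by rewrite -leqNgt => le; rewrite nth_default// scale0r.
Qed.

Lemma evD p q x : ev (p + q) x = ev p x + ev q x.
Proof.
pose n := maxn (size p) (size q).
rewrite (@ev_widen n (p + q)) ?size_polyD// (@ev_widen n p) ?leq_maxl//.
rewrite (@ev_widen n q) ?leq_maxr// -big_split /=; apply: eq_bigr => i _.
by rewrite coefD rmorphD scalerDl.
Qed.

Lemma evC a x : ev a%:P x = a%:C *: x.
Proof. by rewrite (@ev_widen 1) ?size_polyC_leq1// big_ord1 coefC. Qed.

Lemma evMX p x : ev (p * 'X) x = T (ev p x).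
Proof.
rewrite (@ev_widen (size p).+1); last first.
  by have [->|p0] := eqVneq p 0; rewrite ?mul0r ?size_poly0// size_mulX.
rewrite big_ord_recl coefMX scale0r add0r (big_morph T (linD lT) (lin0 lT)).
by apply: eq_bigr => i _; rewrite coefMX /= (linZ lT).
Qed.

Lemma ev0 x : ev 0 x = 0. Proof. by rewrite -polyC0 evC scale0r. Qed.

Lemma evM p q x : ev (p * q) x = ev p (ev q x).
Proof.
elim/poly_ind: p => [|p c IH]; first by rewrite mul0r !ev0.
rewrite mulrDl mulrAC !evD !evMX IH; congr (_ + _).
elim/poly_ind: q {IH} => [|q d IH]; first by rewrite mulr0 evC ev0 scaler0.
by rewrite mulrDr mulrA !evD !evMX IH -polyCM !evC (linZ lT) scalerDr scalerA rmorphM.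
Qed.

Lemma evN p x : ev (- p) x = - ev p x.
Proof. by rewrite -mulN1r -polyC1 -polyCN evM evC rmorphN scaleN1r. Qed.

Lemma ev1 x : ev 1 x = x. Proof. by rewrite -polyC1 evC scale1r. Qed.

Lemma evX x : ev 'X x = T x. Proof. by rewrite -['X]mul1r evMX ev1. Qed.

Lemma ev_sym p : adjoint_pair (ev p) (ev p).
Proof.
move=> x y; elim/poly_ind: p x y => [|p c IH] x y.
  by rewrite !ev0 !dotE.
rewrite !evD !dotE !evC !dotE conj_real; congr (_ + _).
by rewrite evMX symT IH evM evX.
Qed.

Definition form p x : R := complex.Re '[ev p x, x].

Lemma formD p q x : form (p + q) x = form p x + form q x.
Proof. by rewrite /form evD dotE raddfD. Qed.

Lemma formB p q x : form (p - q) x = form p x - form q x.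
Proof. by rewrite /form evD evN !dotE raddfB. Qed.

Lemma form_sq p x : form (p * p) x = nsq (ev p x).
Proof. by rewrite /form evM ev_sym. Qed.

(** These are the polynomials nonnegative on [-1, 1], but only membership of
    explicit ones is used.  Positivity of p(T) is stable under products in p on
    this cone for algebraic reasons, without square roots of operators. *)
Inductive cone : {poly R} -> Prop :=
| cone_sq q : cone (q * q)
| cone_sq1 q : cone (q * q * (1 - 'X * 'X))
| cone_add p q : cone p -> cone q -> cone (p + q).

Lemma form_cone p x : cone p -> 0 <= form p x.
Proof.
elim=> {p} [q|q|p q _ p0 _ q0]; first by rewrite form_sq nsq_ge0.
  rewrite (_ : _ * _ = q * q - (q * 'X) * (q * 'X)); last by ring.
  by rewrite formB !form_sq evMX subr_ge0 contrT.
by rewrite formD addr_ge0.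
Qed.

Lemma cone_mul p q : cone p -> cone q -> cone (p * q).
Proof.
move=> cp; elim: cp q => {p} [p|p|p p' _ IH _ IH'] q cq.
3: by rewrite mulrDl; apply: cone_add; [apply: IH|apply: IH'].
all: elim: cq => {q} [q|q|q q' _ IH _ IH']; last by rewrite mulrDr; exact: cone_add.
- by rewrite mulrACA; exact: cone_sq.
- by rewrite mulrA mulrACA; exact: cone_sq1.
- rewrite (_ : _ * _ = (p * q) * (p * q) * (1 - 'X * 'X)); last by ring.
  exact: cone_sq1.
- (* the product of two terms of the second kind is a square *)
  rewrite [X in cone X](_ : _ =
    (p * q * (1 - 'X * 'X)) * (p * q * (1 - 'X * 'X))); last by ring.
  exact: cone_sq.
Qed.

Lemma cone1 : cone 1. Proof. by have := cone_sq 1; rewrite mulr1. Qed.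

Lemma cone0 : cone 0. Proof. by have := cone_sq 0; rewrite mulr0. Qed.

Let h : {poly R} := (2^-1)%:P.
Let hh : h + h = 1.
Proof. by rewrite /h -polyCD (_ : 2^-1 + 2^-1 = 1 :> R)//; lra. Qed.
Let coneh : cone h.
Proof.
by rewrite -[h]mulr1 -hh mulrDr; apply: cone_add; exact: cone_sq.
Qed.

(** The Newton-Schulz iteration x |-> x (3 - x^2) / 2, which increases to 1 on
    ]0, 1], decreases to -1 on [-1, 0[ and fixes 0. *)
Fixpoint sgn n : {poly R} :=
  if n is m.+1 then h * sgn m * (1 + 1 + 1 - sgn m * sgn m) else 'X.

(** With k = 1 - x^2, the next value of k is k^2 (3 + k) / 4. *)
Lemma cone_sgn_le1 n : cone (1 - sgn n * sgn n).
Proof.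
elim: n => [|n IH] /=.
  by rewrite -[X in cone X]mul1r -[X in X * _]mulr1; exact: cone_sq1.
set x := sgn n in IH *; set k := (1 - x * x).
have -> : 1 - h * x * (1 + 1 + 1 - x * x) * (h * x * (1 + 1 + 1 - x * x)) =
    (h * k) * (h * k) * (1 + 1 + 1 + k).
  rewrite -[X in X - _]mulr1 -{1 2}hh /k.
  by ring.
apply: cone_mul; first exact: cone_sq.
by do !apply: cone_add => //; exact: cone1.
Qed.

Let sgnS_sub n : sgn n.+1 - sgn n = sgn n * h * (1 - sgn n * sgn n).
Proof. by rewrite /= -[X in _ - X = _]mulr1 -{4}hh; ring. Qed.

(** Two iterates have the same sign, and the later one has the larger absolute
    value. *)
Lemma cone_sgnM m n : (n <= m)%N ->
  cone (sgn m * sgn n) /\ cone (sgn m * sgn n - sgn n * sgn n).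
Proof.
elim: m => [|m IH].
  by rewrite leqn0 => /eqP->; rewrite subrr; split; [exact: cone_sq|exact: cone0].
rewrite leq_eqVlt => /orP[/eqP->|/IH[c1 c2]].
  by rewrite subrr; split; [exact: cone_sq|exact: cone0].
have c3 : cone (sgn m * sgn n * h * (1 - sgn m * sgn m)).
  by apply: cone_mul (cone_sgn_le1 m); apply: cone_mul.
have -> : sgn m.+1 * sgn n =
    sgn m * sgn n + sgn m * sgn n * h * (1 - sgn m * sgn m).
  by rewrite -[sgn m.+1](subrK (sgn m)) sgnS_sub; ring.
split; first exact: cone_add.
by rewrite addrAC; exact: cone_add.
Qed.

(** If y and z have the same sign and |z| <= |y|, then
    (y - z)^2 <= y^2 - z^2. *)
Lemma sgn_cauchy m n x : (n <= m)%N ->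
  nsq (ev (sgn m) x - ev (sgn n) x) <=
  form (sgn m * sgn m) x - form (sgn n * sgn n) x.
Proof.
move=> /cone_sgnM[_ c]; rewrite -evN -evD -form_sq -formB -subr_ge0 -formB.
rewrite (_ : _ - _ = (sgn m * sgn n - sgn n * sgn n) +
  (sgn m * sgn n - sgn n * sgn n)); last by ring.
exact/form_cone/cone_add.
Qed.

Lemma ev_sgn_contr n x : nsq (ev (sgn n) x) <= nsq x.
Proof.
rewrite -form_sq -[in leRHS](ev1 x) -form_sq mul1r -subr_ge0 -formB.
exact/form_cone/cone_sgn_le1.
Qed.

(** Since the iterates are contractions, replacing [u n] by its limit changes
    the n-th term by at most the norm of the difference. *)
Lemma tends_sgn_comp u l (J0 : H -> H) :
  (forall x, tends (fun n => ev (sgn n) x) (J0 x)) ->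
  tends u l -> tends (fun n => ev (sgn n) (u n)) (J0 l).
Proof.
move=> XJ ul.
have d0 : tends (fun n => ev (sgn n) (u n - l)) 0.
  apply: (@squeeze_cvgr _ \oo _ R (fun=> 0) (fun n => nsq (u n - l))) => //;
    last exact: cvg_cst.
  by apply: nearW => n; rewrite subr0 nsq_ge0 ev_sgn_contr.
have := tendsD d0 (XJ l); rewrite add0r.
by under eq_fun do rewrite -(linD (adjoint_pair_linear (ev_sym _))) subrK.
Qed.

Let sgn_cubed n x : ev (sgn n) (ev (sgn n) (ev (sgn n) x)) =
  3%:C *: ev (sgn n) x + (- 2)%:C *: ev (sgn n.+1) x.
Proof.
rewrite -!evC -!evM -evD; congr (ev _ x).
have -> : 3%:P = 1 + 1 + 1 :> {poly R} by rewrite -!polyCD; congr polyC; lra.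
have -> : (- 2)%:P = - (1 + 1) :> {poly R} by rewrite -polyCD -polyCN.
rewrite /= [RHS](_ : _ = (1 + 1 + 1) * sgn n -
  (h + h) * sgn n * (1 + 1 + 1 - sgn n * sgn n)); last by ring.
by rewrite hh; ring.
Qed.

Let evS n x : ev (sgn n.+1) x = (3 / 2)%:C *: ev (sgn n) x +
  (- 2^-1)%:C *: ev (sgn n) (ev (sgn n) (ev (sgn n) x)).
Proof.
rewrite -!evM -!evC -!evM -evD; congr (ev _ x).
have -> : (3 / 2)%:P = h + h + h by rewrite /h -!polyCD; congr polyC; lra.
have -> : (- 2^-1)%:P = - h by rewrite /h -polyCN.
by rewrite /=; ring.
Qed.

Lemma sgn_divX n : exists q, sgn n = q * 'X.
Proof.
elim: n => [|n [q qE]]; first by exists 1; rewrite mul1r.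
by exists (h * q * (1 + 1 + 1 - sgn n * sgn n)); rewrite /= {1}qE; ring.
Qed.

(** The iterates are odd in T, hence exchange A and B as T does. *)
Lemma sgn_intertwine (A B : H -> H) : linear A -> linear B ->
  (forall x, A (T x) = T (B x)) -> (forall x, B (T x) = T (A x)) ->
  forall n x, A (ev (sgn n) x) = ev (sgn n) (B x) /\
              B (ev (sgn n) x) = ev (sgn n) (A x).
Proof.
move=> lA lB AB BA; elim=> [|n IH] x; first by rewrite /= !evX.
have AX y : A (ev (sgn n) y) = ev (sgn n) (B y) by have [] := IH y.
have BX y : B (ev (sgn n) y) = ev (sgn n) (A y) by have [] := IH y.
rewrite !evS !(linD lA, linD lB, linZ lA, linZ lB).
by rewrite !(AX, BX).
Qed.

(** For the spectral calculus [J0] is sgn(T), and J0^3 = J0 says that its square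
    is the projection on the orthogonal complement of N(T). *)
Theorem sign_operator : exists J0 : H -> H,
  [/\ adjoint_pair J0 J0,
      forall x, J0 (J0 (J0 x)) = J0 x,
      forall x, J0 x = 0 <-> T x = 0 &
      forall A A' B, adjoint_pair A A' -> linear B ->
        (forall x, A (T x) = T (B x)) -> (forall x, B (T x) = T (A x)) ->
        forall x, A (J0 x) = J0 (B x)].
Proof.
have /choice[J0 XJ] : forall x, exists l, tends (fun n => ev (sgn n) x) l.
  move=> x; apply: (@monotone_tends _ (fun n => form (sgn n * sgn n) x) (nsq x)).
    by move=> m n nm; exact: sgn_cauchy.
  by move=> n; rewrite form_sq ev_sgn_contr.
have sJ : adjoint_pair J0 J0.
  by move=> x y; apply: (dot_lim (XJ x) (XJ y)) => n; exact: ev_sym.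
exists J0; split=> // [x|x|A A' B AA' lB AB BA x].
- (* the cubes of the iterates tend to J0^3, and to 3 J0 - 2 J0 by the recursion *)
  apply: (@tends_unique (fun n => ev (sgn n) (ev (sgn n) (ev (sgn n) x)))).
    exact/tends_sgn_comp/tends_sgn_comp.
  have := tendsD (tendsZ 3 (XJ x)) (tendsZ (- 2) (tends_shift (XJ x))).
  rewrite -scalerDl -rmorphD (_ : 3 + - 2 = 1 :> R) ?scale1r; last lra.
  by under eq_fun do rewrite -sgn_cubed.
- split=> [Jx|Tx].
    (* the norms of the iterates at x increase from that of T x *)
    have := XJ x; rewrite Jx => Xx.
    apply/nsq_eq0/eqP; rewrite eq_le nsq_ge0 andbT.
    apply: (le_null_seq Xx) => n; rewrite subr0 -evX -!form_sq.
    rewrite -subr_ge0.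
    exact: le_trans (nsq_ge0 _) (sgn_cauchy x (leq0n n)).
  apply: (tends_unique (XJ x)); rewrite /tends.
  rewrite (_ : (fun n => _) = fun=> 0); first exact: cvg_cst.
  apply/funext => n; have [q ->] := sgn_divX n.
  by rewrite evM evX Tx (lin0 (adjoint_pair_linear (ev_sym _))) subrr nsq0.
- apply: dot_ext => w; rewrite AA' (sJ (B x)).
  apply: (dot_lim (XJ x) (XJ w)) => n; rewrite -AA' -ev_sym.
  by have [-> _] := sgn_intertwine (adjoint_pair_linear AA') lB AB BA n x.
Qed.

End SignOperator.

(** * Hilbert bases *)

Lemma hilbert_basis_exists M : exists B, hilbert_basis dot M B.
Proof.
have [|B [[BM oB] maxB]] := @Zorn_bigcup H
  [set B | B `<=` M /\ orthonormal_set dot B].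
  move=> F FP Ftot; split; first by move=> x [B /FP[BM _] /BM].
  split=> [b [B /FP[_ [oB _]]]|b c [B FB Bb] [C FC Cc]]; first exact: oB.
  have [BC|CB] := Ftot _ _ FB FC.
    by have [_ [_ oC]] := FP _ FC; apply: oC => //; exact: BC.
  by have [_ [_ oB]] := FP _ FB; apply: oB => //; exact: CB.
exists B; split=> // B' B'M oB' BB'; apply/seteqP; split=> //.
by apply: contrapT => nB'B; exact: (maxB B').
Qed.

Lemma hilbert_basis_image (U U' : H -> H) (M N A : set H) :
  adjoint_pair U U' -> U' \o U = idfun -> U \o U' = idfun ->
  (forall x, M x -> N (U x)) -> (forall y, N y -> M (U' y)) ->
  hilbert_basis dot M A -> hilbert_basis dot N (U @` A).
Proof.
move=> UU' U'U_id UU'_id UM U'N [AM [A1 A0] Amax].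
have U'K x : U' (U x) = x by exact: (congr1 (@^~ x) U'U_id).
have UK x : U (U' x) = x by exact: (congr1 (@^~ x) UU'_id).
have dotU x y : '[U x, U y] = '[x, y] by rewrite UU' U'K.
split.
- by move=> _ [a Aa <-]; exact/UM/AM.
- split=> [_ [a Aa <-]|_ _ [a Aa <-] [b Ab <-] ab]; first by rewrite dotU A1.
  by rewrite dotU A0//; apply: contra_neq ab => ->.
- move=> B BN [B1 B0] AB.
  have dotU' x y : '[U' x, U' y] = '[x, y] by rewrite -dotU !UK.
  have <- : U' @` B = A; last first.
    by rewrite image_comp UU'_id image_id.
  apply: Amax.
  + by move=> _ [b Bb <-]; exact/U'N/BN.
  + split=> [_ [b Bb <-]|_ _ [b Bb <-] [c Bc <-] bc]; first by rewrite dotU' B1.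
    by rewrite dotU' B0//; apply: contra_neq bc => ->.
  + by move=> a Aa; exists (U a); [apply: AB; exists a|rewrite U'K].
Qed.

Lemma eq_hilbert_dim_unitary (U U' : H -> H) (M N : set H) :
  adjoint_pair U U' -> U' \o U = idfun -> U \o U' = idfun ->
  (forall x, M x -> N (U x)) -> (forall y, N y -> M (U' y)) ->
  eq_hilbert_dim dot M N.
Proof.
move=> UU' U'U_id UU'_id UM U'N; have [A AM] := hilbert_basis_exists M.
exists A, (U @` A); split=> //; first exact: hilbert_basis_image AM.
rewrite card_eq_sym; apply: inj_card_eq => x y _ _ Uxy.
by rewrite -[x]/(idfun x) -[y]/(idfun y) -U'U_id /= Uxy.
Qed.

(** Distinct elements of [A] are at distance sqrt 2, so that their approximations
    within 1/2 by a countable dense set are distinct. *)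
Lemma orthonormal_countable A :
  separable H -> orthonormal_set dot A -> countable A.
Proof.
move=> [D /countable_injP[g ginj] Ddense] [A1 A0].
have /choice[d dP] : forall x : H, exists y, D y /\ nsq (x - y) < 2^-1 ^+ 2.
  move=> x; have [] := Ddense (ball x (2^-1 : R)%:C).
  - by exists x; apply: ballxx; rewrite ltcR invr_gt0.
  - exact: ball_open.
  move=> y [+ Dy]; rewrite -ball_normE /ball_ /= => xy; exists y; split=> //.
  move: xy; rewrite -ltr_sqr ?nnegrE ?ler0c ?invr_ge0// dot_norm nsqE.
  by rewrite -rmorphXn ltcR.
apply/countable_injP; exists (g \o d) => a b /set_mem Aa /set_mem Ab /= gab.
have dab : d a = d b.
  by apply: ginj gab; rewrite inE; [have [] := dP a|have [] := dP b].
apply: contrapT => /eqP ab.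
have nab : nsq (a - b) = 2.
  by rewrite nsqB /nsq (A0 a b)// (A1 a)// (A1 b)//=; lra.
have := nsqD_le (a - d a) (d a - b); rewrite addrA subrK nab.
have [_] := dP a; have [_] := dP b.
by rewrite -nsqN opprB -dab; lra.
Qed.

(** Otherwise the normalization of [x] would enlarge [A]. *)
Lemma maximal_orthogonal (S : H -> H) A x : linear S ->
  hilbert_basis dot (null_space S) A -> S x = 0 ->
  (forall a, A a -> '[x, a] = 0) -> x = 0.
Proof.
move=> lS [AS [A1 A0] Amax] Sx xA; apply: contrapT => /eqP x0.
have nx : 0 < nsq x.
  by rewrite lt0r nsq_ge0 andbT; apply: contra_neq x0; exact: nsq_eq0.
pose e := (Num.sqrt (nsq x))^-1%:C *: x.
have eA a : A a -> '[e, a] = 0 by move=> Aa; rewrite dotZl xA// mulr0.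
have ee : '[e, e] = 1.
  by rewrite nsqE nsqZ exprVn sqr_sqrtr ?ltW// mulVf ?gt_eqF.
have : (A `|` [set e]) e by right.
rewrite (Amax (A `|` [set e])).
- by move=> /eA; rewrite ee => /eqP; rewrite oner_eq0.
- by move=> _ [/AS//|->]; rewrite /null_space /= (linZ lS) Sx scaler0.
- split=> [_ [/A1//|->//]|a b [Aa|->] [Ab|->] ab] //.
  + exact: A0.
  + by rewrite dotC eA// conjC0.
  + exact: eA.
  + by rewrite eqxx in ab.
- by move=> a; left.
Qed.

(** Zero terms are allowed, so that a finite or countable orthonormal set can
    be listed along any injection into the natural numbers. *)
Definition orthoseq (a : nat -> H) :=
  (forall m n, m != n -> '[a m, a n] = 0) /\
  (forall n, a n = 0 \/ '[a n, a n] = 1).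

Lemma matched_orthoseq (A B : set H) : separable H ->
  orthonormal_set dot A -> orthonormal_set dot B -> (A #= B)%card ->
  exists a b : nat -> H,
    [/\ orthoseq a, orthoseq b, forall n, '[a n, a n] = '[b n, b n],
        (range a `<=` A `|` [set 0]) /\ (A `<=` range a) &
        (range b `<=` B `|` [set 0]) /\ (B `<=` range b)].
Proof.
move=> sepH oA oB /card_set_bijP[phi [phiA phiI phiB]].
have /countable_injP[g gI] := orthonormal_countable sepH oA.
have [A1 A0] := oA; have [B1 B0] := oB.
pose P n x := A x /\ g x = n.
pose at_ n :=
  if pselect (exists x, P n x) is left e then Some (projT1 (cid e)) else None.
have at_some n x : at_ n = Some x -> A x /\ g x = n.
  by rewrite /at_; case: pselect => // e [<-]; case: cid.
have at_g x : A x -> at_ (g x) = Some x.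
  move=> Ax; rewrite /at_; case: pselect => [e|[]]; last by exists x.
  by case: cid => y [Ay gy] /=; congr Some; apply: gI; rewrite ?inE.
have at_inj m n x y : at_ m = Some x -> at_ n = Some y -> m != n -> x != y.
  by move=> /at_some[_ <-] /at_some[_ <-]; apply: contra_neq => ->.
pose a n := if at_ n is Some x then x else 0.
pose b n := if at_ n is Some x then phi x else 0.
exists a, b; split.
- split=> [m n mn|n]; rewrite /a.
    case Em : (at_ m) => [x|]; last by rewrite dot0l.
    case En : (at_ n) => [y|]; last by rewrite dot0r.
    have [Ax _] := at_some _ _ Em; have [Ay _] := at_some _ _ En.
    exact: A0 (at_inj _ _ _ _ Em En mn).
  case E : (at_ n) => [x|]; last by left.
  by right; apply: A1; have [] := at_some _ _ E.
- split=> [m n mn|n]; rewrite /b.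
    case Em : (at_ m) => [x|]; last by rewrite dot0l.
    case En : (at_ n) => [y|]; last by rewrite dot0r.
    have [Ax _] := at_some _ _ Em; have [Ay _] := at_some _ _ En.
    apply: B0; [exact: phiA|exact: phiA|].
    apply: contra_neq (at_inj _ _ _ _ Em En mn) => ?.
    by apply: phiI; rewrite ?inE.
  case E : (at_ n) => [x|]; last by left.
  by right; apply/B1/phiA; have [] := at_some _ _ E.
- move=> n; rewrite /a /b; case E : (at_ n) => [x|//].
  by have [Ax _] := at_some _ _ E; rewrite A1// B1//; exact: phiA.
- split=> [_ [n _ <-]|x Ax]; last by exists (g x) => //; rewrite /a at_g.
  rewrite /a; case E : (at_ n) => [x|]; last by right.
  by left; have [] := at_some _ _ E.
- split=> [_ [n _ <-]|y By].
    rewrite /b; case E : (at_ n) => [x|]; last by right.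
    by left; apply: phiA; have [] := at_some _ _ E.
  by have [x Ax <-] := phiB _ By; exists (g x) => //; rewrite /b at_g.
Qed.

(** * Isometries between null spaces *)

Lemma sum_nat_sub (V : zmodType) (F : nat -> V) n m : (n <= m)%N ->
  \sum_(0 <= i < m) F i - \sum_(0 <= i < n) F i = \sum_(n <= i < m) F i.
Proof. by move=> nm; rewrite (big_cat_nat _ nm)//= addrAC subrr add0r. Qed.

Lemma dot_suml (v : nat -> H) m n w :
  '[\sum_(m <= i < n) v i, w] = \sum_(m <= i < n) '[v i, w].
Proof. exact: linear_sumlz. Qed.

Lemma dot_sumr (v : nat -> H) m n w :
  '[w, \sum_(m <= i < n) v i] = \sum_(m <= i < n) '[w, v i].
Proof. exact: linear_sumr. Qed.

Lemma nsq_sum_orthogonal (v : nat -> H) m n :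
  (forall i j, i != j -> '[v i, v j] = 0) ->
  nsq (\sum_(m <= i < n) v i) = \sum_(m <= i < n) nsq (v i).
Proof.
move=> v0; elim: n => [|n IH]; first by rewrite !big_geq// nsq0.
have [mn|nm] := leqP m n; last by rewrite !big_geq// nsq0.
rewrite !big_nat_recr//= nsqD IH.
rewrite (_ : '[_, _] = 0) ?mulr0 ?addr0//.
rewrite dot_suml big_nat big1// => i /andP[_ lt_in].
by apply: v0; rewrite neq_ltn lt_in.
Qed.

(** The partial sums of the partial isometry that sends [a] to [b]. *)
Definition transfer (a b : nat -> H) n (x : H) : H :=
  \sum_(0 <= i < n) '[x, a i] *: b i.

Section Transfer.
Variables a b : nat -> H.
Hypotheses (oa : orthoseq a) (ob : orthoseq b).
Hypothesis ab : forall n, '[a n, a n] = '[b n, b n].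

Lemma orthogonal_scale (e : nat -> H) (c : nat -> R[i]) i j : orthoseq e ->
  i != j -> '[c i *: e i, c j *: e j] = 0.
Proof. by move=> [e0 _] ij; rewrite !dotE e0// !mulr0. Qed.

(** Bessel's inequality for [a], whose terms have the norms of those of [b]. *)
Lemma bessel x n : \sum_(0 <= i < n) nsq ('[x, a i] *: b i) <= nsq x.
Proof.
have ba i : nsq ('[x, a i] *: b i) = nsq ('[x, a i] *: a i).
  by rewrite /nsq !dotE ab.
rewrite (eq_bigr _ (fun i _ => ba i)).
rewrite -(@nsq_sum_orthogonal (fun i => '[x, a i] *: a i)); last first.
  by move=> i j; apply: (@orthogonal_scale a (fun i => '[x, a i])).
set p := \sum_(0 <= i < n) _.
have xp : complex.Re '[x, p] = nsq p.
  rewrite [RHS]nsq_sum_orthogonal; last first.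
    by move=> i j; apply: (@orthogonal_scale a (fun i => '[x, a i])).
  rewrite dot_sumr raddf_sum; apply: eq_bigr => i _ /=.
  rewrite /nsq !dotE; have [_ /(_ i)[->|->]] := oa; last by rewrite mulr1 mulrC.
  by rewrite !dot0r !mul0r mulr0.
by have := nsq_ge0 (x - p); rewrite nsqB xp; lra.
Qed.

Lemma transfer_tends x : exists l, tends (fun n => transfer a b n x) l.
Proof.
apply: (@monotone_tends _
  (fun n => \sum_(0 <= i < n) nsq ('[x, a i] *: b i)) (nsq x)); last exact: bessel.
move=> m n nm; rewrite /transfer !(sum_nat_sub _ nm).
rewrite nsq_sum_orthogonal// => i j.
exact: (@orthogonal_scale b (fun i => '[x, a i])).
Qed.

Lemma transfer_adjoint n : adjoint_pair (transfer a b n) (transfer b a n).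
Proof.
move=> x y; rewrite /transfer dot_suml dot_sumr; apply: eq_bigr => i _.
by rewrite !dotE -dotC mulrC.
Qed.

Lemma transfer_basis j : tends (fun n => transfer a b n (a j)) (b j).
Proof.
apply: cvg_near_cst; exists j.+1 => // n /= jn.
rewrite /transfer (@big_cat_nat _ _ _ j.+1)//= big_nat_recr//=.
have [a0 an] := oa.
rewrite big_nat big1 ?add0r => [|i /andP[_ ij]]; last first.
  by rewrite a0 ?scale0r// neq_ltn ij orbT.
rewrite big_nat big1 ?addr0 => [|i /andP[ij _]]; last first.
  by rewrite a0 ?scale0r// neq_ltn ij.
case: (an j) => aj; last by rewrite aj scale1r subrr nsq0.
have -> : b j = 0 by apply: nsq_eq0; rewrite /nsq -ab aj dot0l.
by rewrite scaler0 subrr nsq0.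
Qed.

End Transfer.

Lemma null_space_tends (S S' : H -> H) u l : adjoint_pair S S' ->
  (forall n, S (u n) = 0) -> tends u l -> S l = 0.
Proof.
move=> SS' Su ul; apply: dot_ext => w; rewrite SS' dot0l -(dot0l w).
have c0 : tends (fun=> 0) 0 by rewrite /tends subrr nsq0; exact: cvg_cst.
rewrite [RHS]dot0l -(dot0r 0); apply: (dot_lim ul c0) => n.
by rewrite -SS' Su !dot0l.
Qed.

(** [W] and [V] are the two transfers between bases of the null spaces.  The
    difference of [V (W x)] and [x] is orthogonal to the first basis. *)
Theorem null_spaces_isometric (S S' T T' : H -> H) : separable H ->
  adjoint_pair S S' -> adjoint_pair T T' ->
  eq_hilbert_dim dot (null_space S) (null_space T) ->
  exists W V : H -> H, [/\ adjoint_pair W V,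
    forall x, T (W x) = 0, forall y, S (V y) = 0,
    forall x, S x = 0 -> V (W x) = x & forall y, T y = 0 -> W (V y) = y].
Proof.
move=> sepH SS' TT' [A [B [hA hB AB]]].
have [AS oA _] := hA; have [BT oB _] := hB.
have [a [b [oa ob ab [aA Aa] [bB Bb]]]] := matched_orthoseq sepH oA oB AB.
have lS := adjoint_pair_linear SS'; have lT := adjoint_pair_linear TT'.
have Sa n : S (a n) = 0.
  by have [/AS//|->] := aA _ (ex_intro2 _ _ n I erefl); rewrite (lin0 lS).
have Tb n : T (b n) = 0.
  by have [/BT//|->] := bB _ (ex_intro2 _ _ n I erefl); rewrite (lin0 lT).
have ba n : '[b n, b n] = '[a n, a n] by rewrite ab.
have /choice[W WP] := transfer_tends oa ob ab.
have /choice[V VP] := transfer_tends ob oa ba.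
have WV : adjoint_pair W V.
  by move=> x y; apply: (dot_lim (WP x) (VP y)) => n; exact: transfer_adjoint.
have VW := adjoint_pairC WV.
have TW x : T (W x) = 0.
  apply: (null_space_tends TT' _ (WP x)) => n; rewrite /transfer.
  rewrite (big_morph T (linD lT) (lin0 lT)) big1// => i _.
  by rewrite (linZ lT) Tb scaler0.
have SV y : S (V y) = 0.
  apply: (null_space_tends SS' _ (VP y)) => n; rewrite /transfer.
  rewrite (big_morph S (linD lS) (lin0 lS)) big1// => i _.
  by rewrite (linZ lS) Sa scaler0.
have Wa j : W (a j) = b j.
  exact: tends_unique (WP (a j)) (transfer_basis oa ab j).
have Vb j : V (b j) = a j.
  exact: tends_unique (VP (b j)) (transfer_basis ob ba j).
exists W, V; split=> // [x Sx|y Ty]; apply/eqP; rewrite -subr_eq0; apply/eqP.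
- apply: (maximal_orthogonal lS hA) => [|_ /Aa[j _ <-]].
    by rewrite (linB lS) SV Sx subr0.
  by rewrite dotBl VW Wa WV Vb subrr.
- apply: (maximal_orthogonal lT hB) => [|_ /Bb[j _ <-]].
    by rewrite (linB lT) TW Ty subr0.
  by rewrite dotBl WV Vb VW Wa subrr.
Qed.

(** * The symmetry attached to an idempotent *)

(** From Q x = - P x and idempotence, Q fixes P x; so <x, P x> equals
    both |P x|^2 and <Q x, P x> = - |P x|^2. *)
Lemma idempotent_null (P Q : H -> H) x : adjoint_pair P Q ->
  (forall y, P (P y) = P y) -> (forall y, Q (Q y) = Q y) ->
  P x + Q x = 0 -> P x = 0 /\ Q x = 0.
Proof.
move=> PQ PP QQ PQ0; have QP := adjoint_pairC PQ.
have lP := adjoint_pair_linear PQ; have lQ := adjoint_pair_linear QP.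
have PxE : P x = - Q x by apply/eqP; rewrite -addr_eq0 PQ0.
have QxE : Q x = - P x by rewrite PxE opprK.
have QPx : Q (P x) = P x by rewrite PxE (linN lQ) QQ.
suff Px : P x = 0 by rewrite QxE Px oppr0.
have e1 : '[P x, P x] = '[x, P x] by rewrite PQ QPx.
have e2 : '[Q x, P x] = '[x, P x] by rewrite QP PP.
apply: nsq_eq0; move: e2; rewrite QxE dotNl -e1 nsqE.
by move=> /(congr1 (@complex.Re R)) /=; lra.
Qed.

Section Idempotent.
Variables P Q : H -> H.
Hypotheses (PQ : adjoint_pair P Q) (PP : forall x, P (P x) = P x).
Let QP := adjoint_pairC PQ.
Let lP := adjoint_pair_linear PQ.
Let lQ := adjoint_pair_linear QP.

Let QQ x : Q (Q x) = Q x.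
Proof. by apply: dot_ext => w; rewrite !QP PP. Qed.

Let sum_sym : adjoint_pair (fun x => P x + Q x) (fun x => P x + Q x).
Proof. by move=> x y; rewrite !dotE PQ QP addrC. Qed.

Let cosum_sym : adjoint_pair (fun x => 2%:R *: x - P x - Q x)
  (fun x => 2%:R *: x - P x - Q x).
Proof. by move=> x y; rewrite !dotE PQ QP rmorph_nat addrAC. Qed.

(** This is [idempotent_null] for the complementary idempotents. *)
Lemma null_cosum x : 2%:R *: x - P x - Q x = 0 -> P x = x /\ Q x = x.
Proof.
rewrite -addrA -opprD scaler_nat mulr2n opprD addrACA => x0.
have [|||/eqP + /eqP] :=
  @idempotent_null (fun x => x - P x) (fun x => x - Q x) x _ _ _ x0.
- by move=> y z; rewrite !dotE PQ.
- by move=> y; rewrite (linB lP) PP subrr subr0.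
- by move=> y; rewrite (linB lQ) QQ subrr subr0.
- by rewrite !subr_eq0 => /eqP/esym ? /eqP/esym ?.
Qed.

Lemma eq_hilbert_dim_conj (U U' : H -> H) :
  adjoint_pair U U' -> U' \o U = idfun -> U \o U' = idfun ->
  U \o P \o U' = (fun x => x - Q x) ->
  eq_hilbert_dim dot (null_space (fun x => P x + Q x))
    (null_space (fun x => 2%:R *: x - P x - Q x)).
Proof.
move=> UU' U'U_id UU'_id UPU'; have lU := adjoint_pair_linear UU'.
have lU' := adjoint_pair_linear (adjoint_pairC UU').
have U'K x : U' (U x) = x by exact: (congr1 (@^~ x) U'U_id).
have UPU'E x : U (P (U' x)) = x - Q x by exact: (congr1 (@^~ x) UPU').
have UQU'E x : U (Q (U' x)) = x - P x.
  apply: dot_ext => y; have U'U := adjoint_pairC UU'.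
  by rewrite UU' QP U'U UPU'E !dotE PQ.
have conj_sum y : U (P (U' y) + Q (U' y)) = 2%:R *: y - P y - Q y.
  by rewrite (linD lU) UPU'E UQU'E addrACA scaler_nat mulr2n [- Q y + _]addrC addrA.
apply: (eq_hilbert_dim_unitary UU') => // [x|y]; rewrite /null_space /= => xy0.
  by rewrite -conj_sum U'K xy0 (lin0 lU).
by rewrite -[LHS]U'K conj_sum xy0 (lin0 lU').
Qed.

(** [J1] exchanges the two summands of N(P - Q) = N(P + Q) + N(2I - P - Q),
    along which [e] decomposes as (e - P e) + P e. *)
Lemma kernel_swap : separable H ->
  eq_hilbert_dim dot (null_space (fun x => P x + Q x))
    (null_space (fun x => 2%:R *: x - P x - Q x)) ->
  exists J1 : H -> H, forall e, P e = Q e ->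
    [/\ P (J1 e) = Q (J1 e), J1 (J1 e) = e, P (J1 e) = J1 (e - P e) &
        forall f, P f = Q f -> '[J1 e, f] = '[e, J1 f]].
Proof.
move=> sepH /(null_spaces_isometric sepH sum_sym cosum_sym).
move=> [W [V [WV /= Wcosum Vsum VWK WVK]]].
have VW := adjoint_pairC WV.
have [lW lV] := (adjoint_pair_linear WV, adjoint_pair_linear VW).
have PW x : P (W x) = W x by have [] := null_cosum (Wcosum x).
have QW x : Q (W x) = W x by have [] := null_cosum (Wcosum x).
have PV x : P (V x) = 0 by have [] := idempotent_null PQ PP QQ (Vsum x).
have QV x : Q (V x) = 0 by have [] := idempotent_null PQ PP QQ (Vsum x).
exists (fun e => W (e - P e) + V (P e)) => e ePQ.
have QPe : Q (P e) = P e by rewrite ePQ QQ.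
have PJ x : P (W (x - P x) + V (P x)) = W (x - P x).
  by rewrite (linD lP) PW PV addr0.
split.
- by rewrite PJ (linD lQ) QW QV addr0.
- rewrite PJ [W (e - P e) + _]addrC addrK WVK ?VWK; first by rewrite addrC subrK.
  + by rewrite (linB lP) (linB lQ) PP QPe ePQ !subrr addr0.
  + by rewrite PP QPe scaler_nat mulr2n addrK subrr.
- by rewrite PJ (linB lP) PP subrr subr0 (lin0 lV) addr0.
- move=> f fPQ; have QPf : Q (P f) = P f by rewrite fPQ QQ.
  have Wf x : '[W x, f] = '[x, V (P f)] by rewrite -PW PQ -fPQ WV.
  have Vf x : '[V x, f] = '[x, W (f - P f)].
    by rewrite -VW dotBr -[in '[V x, P f]]QP QV dot0l subr0.
  have eW x : '[e, W x] = '[P e, W x] by rewrite -{1}PW -QP -ePQ.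
  have eV x : '[e, V x] = '[e - P e, V x] by rewrite dotBl PQ QV dot0r subr0.
  by rewrite dotDl dotDr Wf Vf eW eV addrC.
Qed.

Lemma nsq_adjoint_le (K : R) : (forall x, nsq (P x) <= K * nsq x) ->
  forall x, nsq (Q x) <= K * nsq x.
Proof.
move=> PK x; have [Qx0|Qx0] := eqVneq (nsq (Q x)) 0.
  by rewrite Qx0 (le_trans (nsq_ge0 _) (PK x)).
have Qx : 0 < nsq (Q x) by rewrite lt0r Qx0 nsq_ge0.
rewrite -(ler_pM2l Qx) [leRHS]mulrCA.
have -> : nsq (Q x) * nsq (Q x) = complex.Re '[P (Q x), x] ^+ 2.
  by rewrite PQ expr2.
apply: le_trans (cauchy_schwarz_Re _ _) _.
by rewrite mulrA ler_wpM2r ?nsq_ge0.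
Qed.

Lemma skew_part : bounded_operator P -> exists T : H -> H,
  [/\ adjoint_pair T T, forall x, nsq (T x) <= nsq x,
      forall x, T x = 0 <-> P x = Q x,
      forall x, P (T x) = T (x - Q x) & forall x, Q (T x) = T (x - P x)].
Proof.
move=> /bounded_nsq[K K0 PK]; have QK := nsq_adjoint_le PK.
(* P - Q is bounded by 4 K in squared norm, and c^2 (4 K) <= 1 *)
pose c : R := (4 * K + 1)^-1; have c0 : 0 < c by rewrite invr_gt0; lra.
pose g : R[i] := (0 +i* c)%C.
have gN : Num.conj g = - g by rewrite /g /=; congr (_ +i* _); rewrite oppr0.
have g0 : g != 0 by rewrite eq_complex /= negb_and (gt_eqF c0) orbT.
pose T x := g *: (P x - Q x).
exists T; split.
- by move=> x y; rewrite /T !dotE gN PQ QP; ring.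
- move=> x; have -> : nsq (T x) = c ^+ 2 * nsq (P x - Q x).
    rewrite /T /nsq dotZl dotZr gN; case: ('[_, _]) => u v /=; ring.
  have := nsqD_le (P x) (- Q x); rewrite nsqN => le1.
  have := PK x; have := QK x => le2 le3.
  apply: (@le_trans _ _ (c ^+ 2 * (4 * K * nsq x))).
    by rewrite ler_wpM2l ?sqr_ge0//; lra.
  rewrite mulrA ler_piMl ?nsq_ge0//.
  have cE : c * (4 * K + 1) = 1 by rewrite mulVf// gt_eqF//; lra.
  by nra.
- move=> x; split=> [/eqP|xPQ]; last by rewrite /T xPQ subrr scaler0.
  by rewrite scaler_eq0 (negPf g0) subr_eq0 => /eqP.
- move=> x; rewrite /T (linZ lP) !(linB lP) !(linB lQ) PP QQ.
  by rewrite subrr subr0.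
- move=> x; rewrite /T (linZ lQ) !(linB lP) !(linB lQ) PP QQ.
  by rewrite subrr sub0r opprB.
Qed.

(** With J0 the sign of i(P - Q) and E the projection on N(P - Q), J0 + J1 E is
    an orthogonal sum of symmetries of the two complementary subspaces. *)
Theorem idempotent_symmetry : separable H -> bounded_operator P ->
  eq_hilbert_dim dot (null_space (fun x => P x + Q x))
    (null_space (fun x => 2%:R *: x - P x - Q x)) ->
  exists J : H -> H, [/\ adjoint_pair J J, forall x, J (J x) = x &
    forall x, J (P (J x)) = x - Q x].
Proof.
move=> sepH bP /(kernel_swap sepH)[J1 J1P].
have [T [symT contrT T0 PT QT]] := skew_part bP.
have lT := adjoint_pair_linear symT.
have [J0 [sJ0 J0K J0T J0int]] := sign_operator symT contrT.
have lJ0 := adjoint_pair_linear sJ0.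
have PJ0 x : P (J0 x) = J0 (x - Q x).
  apply: (J0int P Q (fun x => x - Q x)) => //; last first.
    by move=> y; rewrite QT (linB lT) opprB addrC subrK.
  by move=> a u v; rewrite lQ scalerBr opprD addrACA.
have QJ0 x : Q (J0 x) = J0 (x - P x).
  apply: (J0int Q P (fun x => x - P x)) => //; last first.
    by move=> y; rewrite PT (linB lT) opprB addrC subrK.
  by move=> a u v; rewrite lP scalerBr opprD addrACA.
have J0P x : J0 (P x) = J0 x - Q (J0 x).
  by rewrite QJ0 (linB lJ0) opprB addrC subrK.
pose E x := x - J0 (J0 x).
have J0E x : J0 (E x) = 0 by rewrite (linB lJ0) J0K subrr.
have EPQ x : P (E x) = Q (E x) by apply/T0/J0T.
have J0ker e : P e = Q e -> J0 e = 0 by move=> /T0/J0T.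
have sE : adjoint_pair E E by move=> x y; rewrite /E !dotE !sJ0.
have dotE_ker x e : P e = Q e -> '[e, E x] = '[e, x].
  by move=> eK; rewrite /E dotBr -sJ0 J0ker// dot0l subr0.
pose J x := J0 x + J1 (E x).
have sJ : adjoint_pair J J.
  move=> x y; rewrite /J dotDl dotDr sJ0; congr (_ + _).
  have [Kx _ _ sx] := J1P _ (EPQ x); have [Ky _ _ _] := J1P _ (EPQ y).
  by rewrite -dotE_ker// sx// sE /E (J0ker _ Ky) (lin0 lJ0) subr0.
have EJ x : E (J x) = J1 (E x).
  have [Kx _ _ _] := J1P _ (EPQ x).
  rewrite /E /J !(linD lJ0) (J0ker _ Kx) (lin0 lJ0) !addr0 J0K.
  by rewrite addrAC subrr add0r.
have JK x : J (J x) = x.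
  have [Kx J1K _ _] := J1P _ (EPQ x).
  by rewrite {1}/J EJ J1K (linD lJ0) (J0ker _ Kx) addr0 /E addrC subrK.
have PJ x : P (J x) = J (x - Q x).
  have [_ _ PJ1 _] := J1P _ (EPQ x).
  rewrite /J (linD lP) PJ0 PJ1; congr (_ + J1 _).
  rewrite EPQ /E -PJ0 J0P (linB lQ) !opprB addrACA [RHS]addrACA.
  by congr (_ + _); exact: addrC.
by exists J; split=> // x; rewrite PJ JK.
Qed.

End Idempotent.
End InnerProduct.
Theorem theorem3p4 (R : realType) (H : completeNormedModType R[i])
    (dot : {dot H for Num.conj}) (dot_norm : induces_norm dot)
    (H_separable : separable H)
    (P : H -> H) (P_idem : idempotent_operator P) :
  [<->
    (exists J : H -> H,
       symmetry dot J /\ J \o P \o J = (fun x => x - adjoint dot P x));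
    eq_hilbert_dim dot
      (null_space (fun x => P x + adjoint dot P x))
      (null_space (fun x => 2%:R *: x - P x - adjoint dot P x));
    (exists U : H -> H,
       unitary dot U /\
       U \o P \o adjoint dot U = (fun x => x - adjoint dot P x))
  ].
Proof.
have [bP PoP] := P_idem.
have PP x : P (P x) = P x by exact: (congr1 (@^~ x) PoP).
have PQ := adjointP dot_norm bP.
have dim_of_unitary : (exists U : H -> H, unitary dot U /\
    U \o P \o adjoint dot U = (fun x => x - adjoint dot P x)) ->
  eq_hilbert_dim dot (null_space (fun x => P x + adjoint dot P x))
    (null_space (fun x => 2%:R *: x - P x - adjoint dot P x)).
  move=> [U [[bU U'U UU'] UPU']].
  exact: (eq_hilbert_dim_conj dot_norm PQ (adjointP dot_norm bU)).
have unitary_of_symmetry : (exists J : H -> H,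
     symmetry dot J /\ J \o P \o J = (fun x => x - adjoint dot P x)) ->
  exists U : H -> H, unitary dot U /\
    U \o P \o adjoint dot U = (fun x => x - adjoint dot P x).
  by move=> [J [[bJ J' JJ] JPJ]]; exists J; rewrite /unitary J'.
have symmetry_of_dim : eq_hilbert_dim dot
    (null_space (fun x => P x + adjoint dot P x))
    (null_space (fun x => 2%:R *: x - P x - adjoint dot P x)) ->
  exists J : H -> H,
     symmetry dot J /\ J \o P \o J = (fun x => x - adjoint dot P x).
  move=> /(idempotent_symmetry dot_norm PQ PP H_separable bP)[J [sJ JJ JPJ]].
  have bJ : bounded_operator J.
    apply: (nsq_bounded dot_norm (K := 1) (adjoint_pair_linear dot_norm sJ)) => x.
    by rewrite expr1n mul1r /nsq sJ JJ.
  exists J; split; last exact/funext.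
  split=> //; last exact/funext.
  exact: (adjoint_pair_inj dot_norm (adjointP dot_norm bJ) sJ).
tfae.
- by move/unitary_of_symmetry/dim_of_unitary.
- by move/symmetry_of_dim/unitary_of_symmetry.
- by move/dim_of_unitary/symmetry_of_dim.
Qed.
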